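(* Let $\Sigma$ be a compact Hausdorff space, $X=\Sigma^{\mathbb Z}$ with the product topology, $S:X\to X$ the left shift, and let $x\in X$ satisfy $$\limsup_{p\to\infty} M_p(x)=\infty .$$ Then the orbit closure $\overline{\mathrm{Orb}(x)}$ contains a Toeplitz sequence. If in addition the point $x$ is recurrent, then the dynamical system $(\overline{\mathrm{Orb}(x)},S)$ is Toeplitz, i.e. there exists a Toeplitz sequence $\eta\in X$ with $\overline{\mathrm{Orb}(x)}=\overline{\mathrm{Orb}(\eta)}$.
   Context: $\mathbb N=\{1,2,\dots\}$. Elements of $X$ are written $x=(x(n))_{n\in\mathbb Z}$; the left shift is the homeomorphism $(Sx)(n)=x(n+1)$. $\mathrm{Orb}(x)=\{S^k x: k\in\mathbb Z\}$ and the bar denotes closure in $X$. For $x\in X$, $p\in\mathbb N$, $\sigma\in\Sigma$: $\mathrm{Per}_p(x,\sigma)=\{n\in\mathbb Z : x(n')=\sigma \text{ for all } n'\equiv n \pmod p\}$, $\mathrm{Per}_p(x)=\bigcup_{\sigma\in\Sigma}\mathrm{Per}_p(x,\sigma)$, $\mathrm{Aper}(x)=\mathbb Z\setminus\bigcup_{p\in\mathbb N}\mathrm{Per}_p(x)$. $M_p(x)=\max\{k\in\mathbb N : \exists n\in\mathbb Z,\ n+i\in\mathrm{Per}_p(x) \text{ for } i=0,1,\dots,k-1\}$, the maximal length of a block of consecutive integers contained in $\mathrm{Per}_p(x)$ (with value $\infty$ if such lengths are unbounded, and $0$ if $\mathrm{Per}_p(x)=\emptyset$). A sequence $\eta\in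 X$ is Toeplitz if $\mathrm{Aper}(\eta)=\emptyset$; in that case the dynamical system $(\overline{\mathrm{Orb}(\eta)},S)$ is also called Toeplitz. A point $x$ is recurrent (in this paper's sense) if for every open neighbourhood $U$ of $x$ there is $n(U)\in\mathbb N$ such that for every $k\in\mathbb Z$, $U\cap\{S^i x: k\le i\le k+n(U)-1\}\ne\emptyset$. *)

(* Defs.v *)
From HB Require Import structures.
From mathcomp Require Export all_boot all_order all_algebra.
From mathcomp Require Export all_classical all_reals all_analysis.

Set Implicit Arguments.
Unset Strict Implicit.
Unset Printing Implicit Defensive.
Import Order.TTheory GRing.Theory Num.Theory.
Local Open Scope classical_set_scope.
Local Open Scope ring_scope.

Section Shift.
Context {Sigma : topologicalType}.
Local Notation X := {ptws int -> Sigma}.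
Implicit Types (x : X) (n k : int).

Definition shift x : X := fun n => x (n + 1).

Definition shift_inv x : X := fun n => x (n - 1).

Lemma shiftK : cancel shift shift_inv.
Proof. by move=> x; apply/funext => n; rewrite /shift_inv /shift subrK. Qed.

Lemma shift_invK : cancel shift_inv shift.
Proof. by move=> x; apply/funext => n; rewrite /shift_inv /shift addrK. Qed.

(* S^k for an integer k; recall that [Negz m] is the integer -(m+1). *)
Definition shift_pow k : X -> X :=
  match k with
  | Posz m => iter m shift
  | Negz m => iter m.+1 shift_inv
  end.

Lemma shift_powE k x n : shift_pow k x n = x (n + k).
Proof.
case: k => m /=.
  elim: m n => [|m IHm] n /=; first by rewrite addr0.
  by rewrite /shift IHm -addn1 PoszD -addrA [1 + _]addrC.
rewrite NegzE; elim: m n => [|m IHm] n //.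
by rewrite iterS {1}/shift_inv IHm -addrA -opprD -PoszD.
Qed.

Definition orbit x : set X := [set shift_pow k x | k in [set: int]].

Definition recurrent x : Prop :=
  forall U : set X, open U -> U x ->
  exists2 N : nat, (0 < N)%N &
    forall k : int,
      U `&` [set shift_pow i x | i in [set i : int | k <= i <= k + N%:Z - 1]]
      !=set0.

End Shift.

Section Periodic.
Context {Sigma : Type}.
Implicit Types (x : int -> Sigma) (p : nat).

Definition Per_at p x (s : Sigma) : set int :=
  [set n | forall n' : int, (n' = n %[mod p])%Z -> x n' = s].

Definition Per p x : set int := \bigcup_(s in [set: Sigma]) Per_at p x s.

Definition Aper x : set int :=
  ~` \bigcup_(p in [set p : nat | (0 < p)%N]) Per p x.

(* The supremum of a set of natural numbers containing k = 0: it is the maximal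
   block length when the lengths are bounded, +oo when they are not, and 0 when
   [Per p x] is empty. *)
Definition maxblock (R : realType) p x : \bar R :=
  ereal_sup [set k%:R%:E | k in [set k : nat |
    exists n : int, forall i : nat, (i < k)%N -> Per p x (n + i%:Z)]].

Definition toeplitz x : Prop := Aper x = set0.

End Periodic.

(* Main.v *)
Require Import Defs.
From mathcomp Require Import zify.

(** Long blocks of periodic positions can be nested.  Given a centre [m] and a
    period [q], a block in some [Per p x] that is long compared with [q]
    contains a new centre which is congruent to [m] modulo [q] and far from both
    ends of the block ([blocks_refine]).  Along the resulting sequence of
    centres, the shifts of [x] agree from some stage on at each coordinate [n]
    and at all translates of [n] by one fixed period.  Hence they converge
    pointwise, and every coordinate of the limit is periodic: the limit is a
    Toeplitz point of the orbit closure ([closure_orbit_toeplitz]).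

    If [x] is recurrent, its return times to any neighbourhood have bounded
    gaps, and in a regular space this makes the orbit closure minimal: [x] lies
    in the orbit closure of each of its points ([recurrent_closure_orbit]).
    Applied to the Toeplitz point, this gives both inclusions between the two
    orbit closures.  Compactness and separation of the alphabet serve to make
    the sequence space regular ([ptws_regular]). *)

Set Implicit Arguments.
Unset Strict Implicit.
Unset Printing Implicit Defensive.
Import Order.TTheory GRing.Theory Num.Theory.
Local Open Scope classical_set_scope.
Local Open Scope ring_scope.

(** This reduces both the continuity of the shift and the convergence of the
    approximating shifts to statements about single coordinates. *)
Lemma ptws_cvg (I : Type) (T : topologicalType) (F : set_system {ptws I -> T})
    (f : {ptws I -> T}) : Filter F ->
  (forall i, (fun g : {ptws I -> T} => g i) @ F --> f i) -> F --> f.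
Proof.
move=> FF cvF; apply/cvg_sup => i A [_ [[B oB <-] Bfi] sBA].
by apply: filterS sBA _; apply: cvF; exact: open_nbhs_nbhs.
Qed.

Lemma ptws_regular (I : eqType) (T : topologicalType) :
  compact [set: T] -> hausdorff_space T -> regular_space {ptws I -> T}.
Proof.
move=> cptT T2T f.
apply: (@compact_regular {ptws I -> T} f setT); last exact: filterT.
  exact: (@hausdorff_product I (fun=> T)).
have := @tychonoff I (fun=> T) (fun=> setT) (fun=> cptT).
by congr compact; apply/seteqP; split.
Qed.

Section OrbitClosure.
Context {Sigma : topologicalType}.
Local Notation X := {ptws int -> Sigma}.
Implicit Types (x y : X) (k l : int).

Lemma shift_powD k l x : shift_pow k (shift_pow l x) = shift_pow (k + l) x.
Proof. by apply/funext => n; rewrite !shift_powE addrA. Qed.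

Lemma shift_pow_continuous k : continuous (shift_pow k : X -> X).
Proof.
move=> x; apply: ptws_cvg => [|n A];
  first exact: (@fmap_filter _ _ (shift_pow k) _ (@nbhs_filter X x)).
rewrite shift_powE => nA.
have : nbhs x ((fun y : X => y (n + k)) @^-1` A).
  exact: (@proj_continuous int (fun=> Sigma) (n + k) x A nA).
by apply: filterS => y /=; rewrite shift_powE.
Qed.

(** The orbit closure of [x] is closed, and invariant because the powers of the
    shift are continuous. *)
Lemma closure_orbit_sub x y :
  closure (orbit x) y -> closure (orbit y) `<=` closure (orbit x).
Proof.
move=> xy; suff /closureS : orbit y `<=` closure (orbit x).
  by rewrite -(closure_id (closure (orbit x))).1 //; exact: closed_closure.
move=> _ [k _ <-] B /shift_pow_continuous /xy [_ [[l _ <-] /=]].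
rewrite shift_powD => Bx.
by exists (shift_pow (k + l) x); split=> //; exists (k + l).
Qed.

(** Almost periodic points have minimal orbit closures.  If [V] is a
    neighbourhood of [x], bounded return times put the whole orbit of [x] into
    finitely many shifted copies of the closure of [V].  Their union is closed,
    so it also contains every [y] in the orbit closure, which means that a shift
    of [y] lies in the closure of [V]; by regularity that closure can be taken
    inside any prescribed neighbourhood of [x]. *)
Lemma recurrent_closure_orbit x y :
  {for x, regular_space X} -> recurrent x ->
  closure (orbit x) y -> closure (orbit y) x.
Proof.
move=> regx recx xy A /regx [V Vx sVA].
have [|N _ hN] := recx V° (@open_interior _ _); first exact: Vx.
pose W : set X := \bigcup_(j in `I_N) (shift_pow j%:Z @^-1` closure V).
have closedW : closed W.
  apply: closed_bigcup => // j _.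
  apply: preimage_closed; last exact: closed_closure.
  by move=> z _; exact: shift_pow_continuous.
have orbitW : orbit x `<=` W.
  move=> _ [k _ <-]; have [z [Vz [i /= ki iz]]] := hN k.
  exists `|i - k|%N; first by move=> /=; lia.
  apply: subset_closure; rewrite /preimage /mkset shift_powD (_ : _ + k = i);
    last by lia.
  by rewrite iz; exact: interior_subset.
have [j _ Aj] : W y by apply: closedW; exact: closureS orbitW _ xy.
by exists (shift_pow j%:Z y); split; [exists j%:Z | exact: sVA].
Qed.

End OrbitClosure.

Section Blocks.
Context {Sigma : Type}.
Implicit Types (x : int -> Sigma) (p q : nat) (m n : int).

Lemma PerP p x n : Per p x n <-> forall t : int, x (n + t * p%:Z) = x n.
Proof.
split=> [[s _ xs] t|xn].
  by rewrite (xs n erefl) xs // addrC modzMDl.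
exists (x n) => // n' /eqP; rewrite eqz_mod_dvd => /dvdzP[t nE].
by rewrite -(xn t) -nE addrC subrK.
Qed.

Lemma Per_dvd p q x : (p %| q)%N -> Per p x `<=` Per q x.
Proof.
move=> /dvdnP[r ->] n /PerP xn; apply/PerP => t.
by rewrite PoszM mulrA xn.
Qed.

Definition long_blocks x : Prop :=
  forall L : nat, exists2 p, (0 < p)%N &
    exists n, forall i : nat, (i < L)%N -> Per p x (n + i%:Z).

(** The tail [p > 0] suffices.  It must exclude [p = 0], where congruence is
    equality and [Per 0 x] is all of the integers. *)
Lemma limsup_maxblock_blocks (R : realType) x :
  limn_esup (fun p => maxblock R p x) = +oo%E ->
  long_blocks x.
Proof.
move=> supM L.
have : (L%:R%:E < ereal_sup [set maxblock R p x | p in [set p | (0 < p)%N]])%E.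
  apply: (@lt_le_trans _ _ +oo%E); first exact: ltry.
  rewrite -supM; apply: ereal_inf_lbound.
  by exists [set p | (0 < p)%N] => //; exists 1%N.
move=> /ereal_sup_gt[_ [p p0 <-]] /ereal_sup_gt[_ [k [n nk] <-]].
rewrite lte_fin ltr_nat => Lk; exists p => //.
by exists n => i iL; apply: nk; exact: ltn_trans Lk.
Qed.

(** The inductive step of the construction.  A block of more than [3 * q]
    integers in some [Per p x] contains, among the [q] consecutive candidates
    at distance at least [q] from both of its ends, a centre congruent to [m]
    modulo [q].  Keeping the residue of the centre preserves what the previous
    stages have fixed; making the new period a multiple of [q] lets the
    congruences accumulate. *)
Lemma blocks_refine x :
  long_blocks x ->
  forall m q, (0 < q)%N -> exists m' q',
    [/\ (q < q')%N, (q %| q')%N, (q%:Z %| m' - m)%Z &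
        forall i : int, `|i| <= q%:Z -> Per q' x (m' + i)].
Proof.
move=> blocks m q q0; have [p p0 [n pern]] := blocks (3 * q).+1.
(* The factor 2 makes the periods increase strictly, so that the windows of
   radius [q] exhaust the integers. *)
exists (n + q%:Z + ((m - (n + q%:Z)) %% q%:Z)%Z), (q * (2 * p))%N.
set r := (_ %% _)%Z.
have q0z : q%:Z != 0 by lia.
have r0 : 0 <= r by exact: modz_ge0.
have rq : r < q%:Z by apply: ltz_pmod; lia.
split=> [||| i iq].
- by nia.
- exact: dvdn_mulr.
- rewrite -eqz_mod_dvd /r modzDmr.
  by rewrite addrC subrK.
apply: (@Per_dvd p); first by rewrite mulnA dvdn_mull.
have -> : n + q%:Z + r + i = n + `|(q%:Z + r + i)%R|%N%:Z by lia.
by apply: pern; lia.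
Qed.

End Blocks.

(** Iterating [blocks_refine] gives centres [m j] and periods [q j], where
    [q j] divides [q k] and [m k - m j] for [j <= k] and the window of radius
    [q j] around [m j.+1] lies in [Per (q j.+1) x].  A position [n] of that
    window, together with its translates by multiples of [q j.+1], then carries
    the same symbol in every shift of [x] by [m k] with [j < k].  So these
    shifts stabilise at every coordinate, and their limit is [q j.+1]-periodic
    at [n]. *)
Lemma closure_orbit_toeplitz (Sigma : topologicalType)
    (x : {ptws int -> Sigma}) :
  long_blocks x ->
  exists2 eta : {ptws int -> Sigma}, closure (orbit x) eta & toeplitz eta.
Proof.
move=> blocks.
pose state := {s : int * nat | (0 < s.2)%N}.
pose refines (s t : state) :=
  [/\ ((sval s).2 < (sval t).2)%N, ((sval s).2 %| (sval t).2)%N,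
      ((sval s).2%:Z %| (sval t).1 - (sval s).1)%Z &
      forall i : int, `|i| <= (sval s).2%:Z ->
        Per (sval t).2 x ((sval t).1 + i)].
have step (s : state) : {t : state | refines s t}.
  apply: cid; case: s => -[m q] /= q0.
  have [m' [q' [qq' *]]] := blocks_refine blocks m q0.
  by exists (exist _ (m', q') (leq_ltn_trans (leq0n q) qq')).
have [s [_ sR]] := dependent_choice step (exist _ (0, 1%N) isT).
pose m j := (sval (s j)).1; pose q j := (sval (s j)).2.
have ltq j : (j < q j)%N.
  elim: j => [|j jq]; first exact: (svalP (s 0%N)).
  by have [+ _ _ _] := sR j; exact: leq_ltn_trans.
have dvdm j k : (j <= k)%N -> (q j %| q k)%N /\ (q j %| m k - m j)%Z.
  move=> /subnK <-; elim: (k - j)%N => [|i [dq dm]].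
    by rewrite add0n subrr dvdz0.
  have [_ dq' dm' _] := sR (i + j)%N.
  rewrite addSn; split; first exact: dvdn_trans dq'.
  rewrite -[m (i + j).+1](subrK (m (i + j)%N)) -addrA.
  by apply: rpredD => //; exact: dvdz_trans dm'.
(* Since [j < q j], the stage following [`|n|] has already treated [n]. *)
pose w (n : int) := (absz n).+1.
pose eta : {ptws int -> Sigma} := fun n => x (m (w n) + n).
have agree (n t : int) k : (w n <= k)%N ->
    x (m k + (n + t * (q (w n))%:Z)) = eta n.
  move=> nk; have [_ /dvdzP[r mE]] := dvdm _ _ nk.
  have [_ _ _ /(_ n)] := sR `|n|%N.
  have nq : `|n| <= (q `|n|%N)%:Z by have := ltq `|n|%N; lia.
  move=> /(_ nq) /PerP/(_ (r + t)) xE; rewrite -[RHS]xE; congr x.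
  by rewrite -/(m (w n)) -/(q (w n)) mulrDl -mE; lia.
have agree0 (n : int) k : (w n <= k)%N -> x (m k + n) = eta n.
  by move=> /(agree n 0); rewrite mul0r addr0.
exists eta.
  have cvg_eta : (fun k => shift_pow (m k) x) @ \oo --> eta.
    apply: ptws_cvg => n A nA; exists (w n) => // k /= nk.
    by rewrite shift_powE addrC agree0 //; exact: nbhs_singleton.
  move=> B /cvg_eta[k _ /(_ k (leqnn k)) /= Bk].
  by exists (shift_pow (m k) x); split=> //; exists (m k).
rewrite /toeplitz -subset0 => n [].
exists (q (w n)); first exact: leq_ltn_trans (ltq _).
apply/PerP => t; set n' := n + _.
rewrite -(agree0 n' (maxn (w n) (w n'))) ?leq_maxr //.
by rewrite agree // leq_maxl.
Qed.

Theorem proposition2 (R : realType) (Sigma : topologicalType)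
    (cptSigma : compact [set: Sigma]) (T2Sigma : hausdorff_space Sigma)
    (x : {ptws int -> Sigma})
    (limsupM : limn_esup (fun p : nat => maxblock R p x) = +oo%E) :
  (exists2 eta : {ptws int -> Sigma}, closure (orbit x) eta & toeplitz eta) /\
  (recurrent x ->
    exists2 eta : {ptws int -> Sigma},
      toeplitz eta & closure (orbit x) = closure (orbit eta)).
Proof.
have [eta xeta etaT] :=
  closure_orbit_toeplitz (limsup_maxblock_blocks limsupM).
split=> [|recx]; exists eta => //.
apply/seteqP; split; last exact: closure_orbit_sub.
apply: closure_orbit_sub; apply: recurrent_closure_orbit xeta => //.
exact: ptws_regular.
Qed.
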